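(* Let $K,T\subset\mathbb{R}^n$ be strictly convex and smooth convex bodies. Let $q=(q_1,\dots,q_m)$ be an $\ell_T$-minimizing closed $(K,T)$-Minkowski billiard trajectory and let $V$ be an affine subspace of $\mathbb{R}^n$ such that $K\cap V$ is the inclusion-minimal affine section of $K$ containing $q$. Then $\dim V=m-1$, i.e., the convex hull of $q_1,\dots,q_m$ has dimension $m-1$.
   Context: A convex body in $\mathbb{R}^n$ is a compact convex set containing the origin in its interior; it is smooth if through each boundary point there is a unique supporting hyperplane. For a convex body $T$, $T^\circ$ is its polar body and $\mu_{T^\circ}(x)=\min\{t\ge 0: x\in tT^\circ\}$. For a convex set $C$ and $z\in\partial C$, $N_C(z)=\{v:\langle v,y-z\rangle\le 0\ \forall y\in C\}$. A closed polygonal curve $(q_1,\dots,q_m)$, $m\ge2$, always satisfies $q_j\ne q_{j+1}$ and $q_j\notin[q_{j-1},q_{j+1}]$ (indices mod $m$); $\ell_T(q)=\sum_j\mu_{T^\circ}(q_{j+1}-q_j)$. A closed polygonal curve $q$ with vertices on $\partial K$ is a closed $(K,T)$-Minkowski billiard trajectory if there are $p_1,\dots,p_m\in\partial T$ with $q_{j+1}-q_j\in N_T(p_j)$ and $p_{j+1}-p_j\in -N_K(q_{j+1})$ for all $j$. It is $\ell_T$-minimizing if its $\ell_T$-length is minimal among all closed $(K,T)$-Minkowski billiard trajectories. An affine section of $K$ is a set $K\cap V$ with $V$ an affine subspace. *)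

(* Defs.v *)
From HB Require Import structures.
From mathcomp Require Import all_boot all_order all_algebra.
From mathcomp Require Import all_classical all_reals all_analysis.
Set Implicit Arguments. Unset Strict Implicit. Unset Printing Implicit Defensive.
Import Order.TTheory GRing.Theory Num.Theory.
Import numFieldNormedType.Exports.
Local Open Scope classical_set_scope.
Local Open Scope ring_scope.

Section Defs.
Variables (R : realType) (n : nat).
Notation V := 'rV[R]_n.

Definition dotp (u v : V) : R := \sum_(i < n) u ord0 i * v ord0 i.

Definition convex_set (C : set V) : Prop :=
  forall x y, C x -> C y -> forall l : R, 0 <= l <= 1 -> C ((1 - l) *: x + l *: y).

Definition convex_body (K : set V) : Prop :=
  compact K /\ convex_set K /\ (interior K) 0.

Definition bdry (C : set V) : set V := closure C `\` interior C.

Definition strictly_convex (K : set V) : Prop :=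
  forall x y, K x -> K y -> x != y -> forall l : R, 0 < l < 1 ->
    (interior K) ((1 - l) *: x + l *: y).

Definition supporting_hyperplane (C : set V) (z : V) (H : set V) : Prop :=
  exists (v : V) (c : R), v != 0 /\ H = [set x | dotp v x = c] /\ H z /\
    forall y, C y -> dotp v y <= c.

Definition smooth_body (K : set V) : Prop :=
  forall z, bdry K z -> exists! H : set V, supporting_hyperplane K z H.

Definition polar (T : set V) : set V := [set y | forall x, T x -> dotp x y <= 1].

Definition scale_set (t : R) (P : set V) : set V := [set t *: y | y in P].

(* mu_{T°}(x) = min {t >= 0 : x \in t T°} (taken as an infimum; it is attained) *)
Definition mu_polar (T : set V) (x : V) : R :=
  inf [set t : R | 0 <= t /\ scale_set t (polar T) x].

Definition normal_cone (C : set V) (z : V) : set V :=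
  [set v | forall y, C y -> dotp v (y - z) <= 0].

Definition segment (a b : V) : set V :=
  [set (1 - l) *: a + l *: b | l in [set l : R | 0 <= l <= 1]].

Definition closed_polygonal (m : nat) (q : 'I_m -> V) : Prop :=
  (2 <= m)%N /\
  forall j : 'I_m, q j != q (ordS j) /\ ~ segment (q (ord_pred j)) (q (ordS j)) (q j).

Definition ell (T : set V) (m : nat) (q : 'I_m -> V) : R :=
  \sum_(j < m) mu_polar T (q (ordS j) - q j).

Definition minkowski_billiard (K T : set V) (m : nat) (q : 'I_m -> V) : Prop :=
  closed_polygonal q /\ (forall j, bdry K (q j)) /\
  exists p : 'I_m -> V, forall j : 'I_m,
    bdry T (p j) /\ normal_cone T (p j) (q (ordS j) - q j) /\
    normal_cone K (q (ordS j)) (- (p (ordS j) - p j)).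

Definition ell_minimizing (K T : set V) (m : nat) (q : 'I_m -> V) : Prop :=
  minkowski_billiard K T q /\
  forall (m' : nat) (q' : 'I_m' -> V), minkowski_billiard K T q' -> ell T q <= ell T q'.

Definition aff (a : V) (U : {vspace V}) : set V := [set a + u | u in [set u | u \in U]].

End Defs.

(* Main.v *)
Require Import Defs.
From HB Require Import structures.
From mathcomp Require Import all_boot all_order all_algebra.
From mathcomp Require Import all_classical all_reals all_analysis.
From mathcomp Require Import lra ring zify.
Import Order.TTheory GRing.Theory Num.Theory.
Import numFieldNormedType.Exports.
Local Open Scope classical_set_scope.
Local Open Scope ring_scope.

(* Let p be the dual polygon of q, so that l_T(q) = B(q, p) with
   B(q, p) = sum_j <q_{j+1} - q_j, p_j> = sum_j <q_{j+1}, p_j - p_{j+1}>.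
   If dim conv(q) < m - 1, the edges v_j = q_{j+1} - q_j satisfy, besides
   sum_j v_j = 0, a second linear relation, hence one with coefficients
   mu_j >= 0, not all zero, one of which vanishes: mu_{j0} = 0. Let y be a
   closed polygon with edges mu_j v_j. Moving p_{j0} to p_{j0-1} does not change
   B(y, p), which is the T-length of y, but strictly decreases the K-length
   max_{x in K^m} B(x, p) below l_T(q): K is strictly convex, and consecutive
   p_j are distinct because T is smooth. The pair (y, p)
   thus makes (T-length of y) (K-length of p) / B(y, p) smaller than l_T(q).
   A minimiser of this quotient is, after scaling and translation, a
   (K, T)-billiard trajectory (with possibly repeated vertices, which can be
   dropped) whose l_T-length is the minimum: q is not minimizing. *)

(** * Inner products, normal cones and the gauge of the polar body *)

Section Geometry.
Variables (R : realType) (n : nat).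
Implicit Types (u v w x y z : 'rV[R]_n) (C : set 'rV[R]_n).

Lemma dotpC u v : dotp u v = dotp v u.
Proof. by apply: eq_bigr => i _; rewrite mulrC. Qed.

Lemma dotpDl u v w : dotp (u + v) w = dotp u w + dotp v w.
Proof. by rewrite -big_split; apply: eq_bigr => i _; rewrite mxE mulrDl. Qed.

Lemma dotpZl (k : R) u v : dotp (k *: u) v = k * dotp u v.
Proof. by rewrite mulr_sumr; apply: eq_bigr => i _; rewrite mxE mulrA. Qed.

Lemma dotpNl u v : dotp (- u) v = - dotp u v.
Proof. by rewrite -scaleN1r dotpZl mulN1r. Qed.

Lemma dotpBl u v w : dotp (u - v) w = dotp u w - dotp v w.
Proof. by rewrite dotpDl dotpNl. Qed.

Lemma dotpDr u v w : dotp w (u + v) = dotp w u + dotp w v.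
Proof. by rewrite ![dotp w _]dotpC dotpDl. Qed.

Lemma dotpZr (k : R) u v : dotp u (k *: v) = k * dotp u v.
Proof. by rewrite ![dotp u _]dotpC dotpZl. Qed.

Lemma dotpNr u v : dotp u (- v) = - dotp u v.
Proof. by rewrite ![dotp u _]dotpC dotpNl. Qed.

Lemma dotpBr u v w : dotp w (u - v) = dotp w u - dotp w v.
Proof. by rewrite dotpDr dotpNr. Qed.

Lemma dotp0l u : dotp 0 u = 0.
Proof. by rewrite -(scale0r u) dotpZl mul0r. Qed.

Lemma dotp0r u : dotp u 0 = 0.
Proof. by rewrite dotpC dotp0l. Qed.

Lemma dotp_ge0 u : 0 <= dotp u u.
Proof. by apply: sumr_ge0 => i _; rewrite -expr2 sqr_ge0. Qed.

Lemma dotp_eq0 u : (dotp u u == 0) = (u == 0).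
Proof.
apply/idP/eqP => [|->]; last by rewrite dotp0l.
rewrite psumr_eq0 => [/allP u0|i _]; last by rewrite -expr2 sqr_ge0.
apply/rowP => i; rewrite mxE; apply/eqP.
by have := u0 i (mem_index_enum _); rewrite /= mulf_eq0 orbb.
Qed.

Lemma dotp_gt0 u : u != 0 -> 0 < dotp u u.
Proof. by move=> u0; rewrite lt_def dotp_eq0 u0 dotp_ge0. Qed.

Lemma dotp_delta u (k : 'I_n) : dotp (delta_mx ord0 k) u = u ord0 k.
Proof.
rewrite /dotp (bigD1 k) //= mxE !eqxx mul1r big1 ?addr0 // => i /negPf ik.
by rewrite mxE eqxx ik mul0r.
Qed.

Lemma continuous_sum (T : topologicalType) (I : finType) (F : I -> T -> R) :
  (forall i, continuous (F i)) -> continuous (fun t => \sum_i F i t).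
Proof.
by move=> cF; apply: continuous_big => [|i _]; [exact: add_continuous|exact: cF].
Qed.

Lemma continuous_sub (T : topologicalType) (f g : T -> 'rV[R]_n) :
  continuous f -> continuous g -> continuous (fun t => f t - g t).
Proof. by move=> cf cg t; apply: cvgB; [exact: cf|exact: cg]. Qed.

Lemma continuous_dotp (T : topologicalType) (f g : T -> 'rV[R]_n) :
  continuous f -> continuous g -> continuous (fun t => dotp (f t) (g t)).
Proof.
move=> cf cg; apply: continuous_sum => i t.
apply: cvgM.
  apply: (@continuous_comp _ _ _ f (fun M : 'rV[R]_n => M ord0 i)).
    exact: cf.
  exact: coord_continuous.
apply: (@continuous_comp _ _ _ g (fun M : 'rV[R]_n => M ord0 i)).
  exact: cg.
exact: coord_continuous.
Qed.

Lemma interior_box C z : C° z ->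
  exists2 e : R, 0 < e &
    forall y, (forall k, `|y ord0 k - z ord0 k| < e) -> C y.
Proof.
move=> /nbhs_ballP[e /= e0 sC]; exists e => // y yz; apply: sC.
by split=> // i j; rewrite (ord1 i) /ball /= distrC yz.
Qed.

Lemma interior_segment C z u : C° z -> exists2 e : R, 0 < e & C (z + e *: u).
Proof.
move=> /interior_box[e e0 sC].
pose s := \sum_k `|u ord0 k| + 1.
have s0 : 0 < s by rewrite ltr_wpDl ?sumr_ge0.
exists (e / s); first exact: divr_gt0.
apply: sC => k; rewrite !mxE addrAC subrr add0r normrM gtr0_norm ?divr_gt0 //.
rewrite -mulrA gtr_pMr // ltr_pdivrMl // mulr1 /s (bigD1 k) //=.
by rewrite -addrA ltrDl ltr_wpDl ?sumr_ge0.
Qed.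

Lemma bdry_compact C z : compact C -> bdry C z -> C z.
Proof.
by move=> cC [+ _]; apply: compact_closed => //; exact: norm_hausdorff.
Qed.

(** For small [e > 0] the point [z + e *: v] still lies in [C], so normality gives
    [e * dotp v v <= 0]. *)
Lemma normal_interior C z v : C° z -> normal_cone C z v -> v = 0.
Proof.
move=> /(interior_segment _ _ v)[e e0 Ce] /(_ _ Ce).
rewrite addrAC subrr add0r dotpZr pmulr_rle0 // => v0.
by apply/eqP; rewrite -dotp_eq0 eq_le v0 dotp_ge0.
Qed.

Lemma normal_dotp_gt0 C z v : C° 0 -> normal_cone C z v -> v != 0 ->
  0 < dotp v z.
Proof.
move=> /(interior_segment _ _ v)[e e0 Ce] /(_ _ Ce) + v0.
rewrite add0r dotpBr dotpZr subr_le0; apply: lt_le_trans.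
by rewrite mulr_gt0 ?dotp_gt0.
Qed.

Lemma normal_dotp_ge0 C z v : C° 0 -> normal_cone C z v -> 0 <= dotp v z.
Proof.
move=> C0 Nv; have [->|v0] := eqVneq v 0; first by rewrite dotp0l.
by rewrite ltW // (normal_dotp_gt0 C).
Qed.

Lemma normal_bdry C z v : C z -> v != 0 -> normal_cone C z v -> bdry C z.
Proof.
move=> Cz v0 Nv; split; first exact: subset_closure.
by move=> /normal_interior /(_ Nv) /eqP; rewrite (negPf v0).
Qed.

Lemma normal_coneP C z v :
  normal_cone C z v <-> forall y, C y -> dotp v y <= dotp v z.
Proof.
by split=> N y Cy; have := N y Cy; rewrite dotpBr subr_le0.
Qed.

(** Two distinct maximisers of [dotp v] would have a maximising midpoint; by strict convexity it is
    interior, where only the zero vector is normal. *)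
Lemma strictly_convex_normal_inj C x y v : strictly_convex C -> v != 0 ->
  C x -> C y -> normal_cone C x v -> normal_cone C y v -> x = y.
Proof.
move=> sC v0 Cx Cy /normal_coneP Nx /normal_coneP Ny.
apply/eqP; apply: contraT => xy.
have half : 0 < (2^-1 : R) < 1 by apply/andP; split; lra.
have /normal_interior mid := sC _ _ Cx Cy xy 2^-1 half.
suff /mid v1 : normal_cone C ((1 - 2^-1) *: x + 2^-1 *: y) v.
  by rewrite v1 eqxx in v0.
apply/normal_coneP => w Cw.
have := Nx _ Cw; have := Ny _ Cw; have := Nx _ Cy; have := Ny _ Cx.
by rewrite dotpDr !dotpZr; lra.
Qed.

(** The gauge of the polar is the support function of [C], attained at [z] by normality: the
    admissible [t] are exactly those with [dotp v z <= t]. *)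
Lemma mu_polarE C z v :
  C° 0 -> C z -> normal_cone C z v -> mu_polar C v = dotp v z.
Proof.
move=> C0 Cz Nv; have vz0 := normal_dotp_ge0 C z v C0 Nv.
suff -> : mu_polar C v = inf [set t | dotp v z <= t].
  rewrite (_ : [set t | _] = `[dotp v z, +oo[%classic) ?inf_itv //.
  by apply/seteqP; split => t /=; rewrite in_itv /= andbT.
congr inf; apply/seteqP; split => t /=.
  move=> [t0 [y Py <-]]; rewrite dotpZl -[leRHS]mulr1 ler_wpM2l //.
  by rewrite dotpC; exact: Py.
move=> zt; have t0 := le_trans vz0 zt; split=> //.
have [te|tn] := eqVneq t 0.
  exists 0; first by move=> x _; rewrite dotp0r.
  rewrite scaler0; apply/eqP; rewrite eq_sym; apply: contraT => v0.
  have := normal_dotp_gt0 C z v C0 Nv v0.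
  by rewrite ltNge -te zt.
exists (t^-1 *: v); last by rewrite scalerA divff // scale1r.
move=> x Cx; rewrite dotpZr dotpC ler_pdivrMl ?lt_def ?tn // mulr1.
by apply: le_trans zt; move/normal_coneP: Nv; apply.
Qed.

(** Both normals define supporting hyperplanes at [z], which coincide by smoothness. The part [u] of
    [w] orthogonal to [v] is then orthogonal to [w] too, so it vanishes; the sign of [c] comes from
    [0 < dotp v z] and [0 < dotp w z]. *)
Lemma smooth_normal_parallel C z v w : C° 0 -> smooth_body C -> bdry C z ->
  v != 0 -> w != 0 -> normal_cone C z v -> normal_cone C z w ->
  exists2 c : R, 0 < c & w = c *: v.
Proof.
move=> C0 sC /sC [H [_ uH]] v0 w0 Nv Nw.
have vz := normal_dotp_gt0 _ _ _ C0 Nv v0.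
have wz := normal_dotp_gt0 _ _ _ C0 Nw w0.
have supp u : u != 0 -> normal_cone C z u ->
    supporting_hyperplane C z [set x | dotp u x = dotp u z].
  by move=> u0 /normal_coneP Nu; exists u, (dotp u z).
have Hvw : [set x | dotp v x = dotp v z] = [set x | dotp w x = dotp w z].
  by rewrite -(uH _ (supp _ v0 Nv)) -(uH _ (supp _ w0 Nw)).
have vv := dotp_gt0 _ v0; have vvn : dotp v v != 0 by rewrite gt_eqF.
pose c := dotp w v / dotp v v; pose u := w - c *: v.
have vu : dotp v u = 0 by rewrite /u dotpBr dotpZr /c dotpC divfK // subrr.
have wu : dotp w u = 0.
  have : [set x | dotp v x = dotp v z] (z + u) by rewrite /= dotpDr vu addr0.
  by rewrite Hvw /= dotpDr -[RHS]addr0 => /addrI.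
have wcv : w = c *: v.
  apply/eqP; rewrite -subr_eq0 -dotp_eq0 -/u {1}/u dotpBl dotpZl wu vu.
  by rewrite mulr0 subrr.
exists c => //; move: wz; rewrite {1}wcv dotpZl pmulr_lgt0 //.
Qed.

End Geometry.

(** * The bilinear pairing of closed polygons and its polar sets *)

Section CyclicPairing.
Import ArrowAsProduct.
Variables (R : realType) (m n : nat).
Local Notation cfg := ('I_m -> 'rV[R]_n).
Implicit Types (p q x y : cfg) (C : set 'rV[R]_n) (s : 'I_m -> 'I_m).

(** The form $B$, with a general vertex map [s] so that the same lemmas serve [ordS] on the side of
    $T$ and [ord_pred] on the side of $K$. *)
Definition pairing s q p : R := \sum_(i < m) dotp (q (s i) - q i) (p i).

Definition inside C : set cfg := [set x | forall i, C (x i)].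

(** Summation by parts on a cycle, without boundary terms. *)
Lemma pairing_adjoint s s' q p : cancel s s' -> cancel s' s ->
  pairing s q p = pairing s' p q.
Proof.
move=> sK s'K; rewrite /pairing.
under eq_bigr do rewrite dotpBl.
under [RHS]eq_bigr do rewrite dotpBl.
rewrite !sumrB; congr (_ - _); last by apply: eq_bigr => i _; rewrite dotpC.
rewrite [RHS](reindex s); last by exists s' => i _.
by apply: eq_bigr => i _; rewrite sK dotpC.
Qed.

Lemma pairing_ordS q p : pairing (@ordS m) q p = pairing (@ord_pred m) p q.
Proof. exact: pairing_adjoint (@ordSK m) (@ord_predK m). Qed.

Lemma pairingZl s (k : R) q p :
  pairing s (fun i => k *: q i) p = k * pairing s q p.
Proof. by rewrite mulr_sumr; apply: eq_bigr => i _; rewrite -scalerBr dotpZl. Qed.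

Lemma pairing_subl s q (v : 'rV[R]_n) p :
  pairing s (fun i => q i - v) p = pairing s q p.
Proof.
by apply: eq_bigr => i _; congr dotp; rewrite opprB addrA subrK.
Qed.

Lemma continuous_coord i : continuous (fun x : cfg => x i).
Proof. exact: (@proj_continuous _ (fun=> 'rV[R]_n) i). Qed.

Lemma continuous_edge s i : continuous (fun x : cfg => x (s i) - x i).
Proof. by apply: continuous_sub; exact: continuous_coord. Qed.

Lemma compact_inside C : compact C -> compact (inside C).
Proof. by move=> cC; apply: (@tychonoff _ (fun=> 'rV[R]_n) (fun=> C)). Qed.

Lemma pairing_max s (P Q : set cfg) :
  compact P -> compact Q -> P !=set0 -> Q !=set0 ->
  exists q p, [/\ Q q, P p &
    forall q' p', Q q' -> P p' -> pairing s q' p' <= pairing s q p].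
Proof.
move=> cP cQ [p0 Pp0] [q0 Qq0].
have [||| [q p] /set_mem[/= Qq Pp] M] := @compact_EVT_max _ R
    (fun z : cfg * cfg => pairing s z.1 z.2) (Q `*` P).
- by exists (q0, p0).
- exact: compact_setX.
- apply: continuous_subspaceT; apply: continuous_sum => i.
  apply: continuous_dotp => z.
    apply: (@continuous_comp _ _ _ fst (fun x : cfg => x (s i) - x i)).
      exact: cvg_fst.
    exact: (continuous_edge s i).
  apply: (@continuous_comp _ _ _ snd (fun x : cfg => x i)).
    exact: cvg_snd.
  exact: (continuous_coord i).
exists q, p; split=> // q' p' Qq' Pp'.
by apply: (M (q', p')); apply/mem_set.
Qed.

(* Nearest-point argument in the compact convex set of the edge vectors of the
   configurations inside [C]. *)
Lemma pairing_separation s C q : compact C -> Defs.convex_set C ->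
  (forall p, exists2 x, inside C x & pairing s q p <= pairing s x p) ->
  exists2 x, inside C x & forall i, x (s i) - x i = q (s i) - q i.
Proof.
move=> cC convC sepq.
pose e x i := q (s i) - q i - (x (s i) - x i).
pose f x := \sum_i dotp (e x i) (e x i).
have [||| x0 /set_mem Cx0 minx0] := @compact_EVT_min _ R f (inside C).
- by have [x Cx _] := sepq (fun=> 0); exists x.
- exact: compact_inside.
- apply: continuous_subspaceT; apply: continuous_sum => i.
  have ce : continuous (e^~ i).
    by apply: continuous_sub; [exact: cst_continuous|exact: continuous_edge].
  exact: continuous_dotp.
(* The hypothesis is tested on the residual of the nearest configuration [x0]. *)
have [z Cz qz] := sepq (e x0).
pose d i := z (s i) - z i - (x0 (s i) - x0 i).
pose N := \sum_i dotp (d i) (e x0 i).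
pose M := \sum_i dotp (d i) (d i).
have M0 : 0 <= M by apply: sumr_ge0 => i _; exact: dotp_ge0.
have fN : f x0 <= N.
  rewrite -subr_ge0 -sumrB.
  rewrite -subr_ge0 -sumrB in qz; apply: le_trans qz _.
  apply: ler_sum => i _; rewrite -!dotpBl /d /e.
  by rewrite [X in X <= _]dotpBl [X in _ <= X]dotpBl !dotpBl; lra.
(* Minimality of [x0] along the segment from [x0] to [z], with [f] expanded in [l]. *)
have var (l : R) : 0 <= l <= 1 -> 2 * l * N <= l ^+ 2 * M.
  move=> l01; pose x i := (1 - l) *: x0 i + l *: z i.
  have Cx : inside C x by move=> i; exact: (convC _ _ (Cx0 i) (Cz i) l l01).
  have := minx0 x (mem_set Cx).
  have -> : f x = f x0 - 2 * l * N + l ^+ 2 * M.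
    rewrite /f /N /M !mulr_sumr -sumrB -big_split; apply: eq_bigr => i _ /=.
    have -> : e x i = e x0 i - l *: d i.
      by rewrite /e /x /d !scalerBl !scale1r; apply/rowP => k; rewrite !mxE; ring.
    move: (e x0 i) (d i) => a b.
    by rewrite !(dotpBl, dotpBr, dotpZl, dotpZr) [dotp a b]dotpC; ring.
  by lra.
have N0 : N <= 0.
  rewrite leNgt; apply/negP => Npos.
  have NM : 0 < N + M by lra.
  (* This [l] lies in [(0, 1]] even when [M = 0], and [var] would give [2 * (N + M) <= M]. *)
  have := var (N / (N + M)).
  have l0 : 0 < N / (N + M) by exact: divr_gt0.
  have -> : 0 <= N / (N + M) <= 1.
    by rewrite (ltW l0) /= ler_pdivrMr // mul1r; lra.
  move=> /(_ isT); rewrite expr2 -mulrA [2 * _]mulrCA -mulrA ler_pM2l //.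
  by rewrite mulrAC ler_pdivlMr //; nra.
have f0 : f x0 = 0.
  apply/eqP; rewrite eq_le (le_trans fN N0) /=.
  by apply: sumr_ge0 => i _; exact: dotp_ge0.
exists x0 => // i; apply/eqP; rewrite eq_sym -subr_eq0 -dotp_eq0.
move: f0 => /eqP; rewrite psumr_eq0 => [/allP/(_ i (mem_index_enum _)) //|j _].
exact: dotp_ge0.
Qed.

(** The polar of $C^m$ under the pairing. Since the pairing ignores translations of [q], the vertex
    [i0] is pinned at the origin to make the set bounded. *)
Definition cyclic_polar s i0 C : set cfg :=
  [set q | q i0 = 0 /\ forall t, inside C t -> pairing s q t <= 1].

(** Test configurations that vanish except at one vertex, where they are plus or minus [e / 2] times
    a coordinate vector, bound each edge coordinate. *)
Lemma cyclic_polar_edge s i0 C : C° 0 ->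
  exists c : R, forall q, cyclic_polar s i0 C q ->
    forall i k, `|(q (s i) - q i) ord0 k| <= c.
Proof.
move=> /interior_box[e e0 sC]; have e20 : 0 < e / 2 by rewrite divr_gt0.
exists (e / 2)^-1 => q [_ qC] i k.
have test (r : R) : `|r| = e / 2 -> r * (q (s i) - q i) ord0 k <= 1.
  move=> re; pose t j : 'rV[R]_n := if j == i then r *: delta_mx ord0 k else 0.
  have : inside C t.
    move=> j; apply: sC => l; rewrite /t; case: eqP => _; rewrite !mxE subr0.
      rewrite eqxx /=; case: eqP => _; rewrite ?mulr0 ?normr0 // mulr1 re.
      by lra.
    by rewrite normr0.
  move/qC; rewrite /pairing (bigD1 i) //= big1 => [|j /negPf ji].
    by rewrite /t eqxx addr0 dotpZr dotpC dotp_delta.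
  by rewrite /t ji dotp0r.
have := test (e / 2); have := test (- (e / 2)).
rewrite normrN gtr0_norm // => /(_ erefl) lo /(_ erefl) hi.
rewrite ler_norml -(ler_pM2l e20) -[_ <= _^-1](ler_pM2l e20) mulrN.
by rewrite divff ?gt_eqF //; lra.
Qed.

(** Every vertex is reached from the pinned one by steps of [s], so the edge bound [c] confines
    vertex [i] to a box of size [findex s i0 i] times [c]. *)
Lemma compact_cyclic_polar s i0 C : C° 0 -> (forall i, fconnect s i0 i) ->
  compact (cyclic_polar s i0 C).
Proof.
move=> C0 conn; have [c qc] := cyclic_polar_edge s i0 C C0.
pose b i := (findex s i0 i)%:R * c.
pose box : set cfg :=
  [set q | forall i,
    [set v : 'rV[R]_n | forall k, `[- b i, b i]%classic (v ord0 k)] (q i)].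
apply: (@subclosed_compact _ _ box).
- have -> : cyclic_polar s i0 C = (fun q : cfg => q i0) @^-1` [set 0] `&`
    \bigcap_(t in inside C)
      ((fun q : cfg => pairing s q t) @^-1` [set r | r <= 1]).
    by apply/seteqP; split.
  apply: closedI.
    apply: preimage_closed => [x _|]; first exact: (continuous_coord i0).
    exact: accessible_closed_set1 (hausdorff_accessible (@norm_hausdorff _ _)) _.
  apply: closed_bigI => t _; apply: preimage_closed; last exact: closed_le.
  move=> x _; apply: continuous_sum => i.
  by apply: continuous_dotp;
    [exact: (continuous_edge s i)|exact: cst_continuous].
- apply: (@tychonoff _ (fun=> 'rV[R]_n) (fun i =>
    [set v : 'rV[R]_n | forall k, `[- b i, b i]%classic (v ord0 k)])) => i.
  apply: (@rV_compact R _ (fun=> `[- b i, b i]%classic)) => k.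
  exact: segment_compact.
- move=> q Pq i k; rewrite /= in_itv /= -ler_norml.
  rewrite -{1}(iter_findex (conn i)) /b.
  elim: (findex _ _ _) => [|j IHj] /=.
    by case: Pq => -> _; rewrite mxE normr0 mul0r.
  rewrite -[q (s _)](subrK (q (iter j s i0))) mxE.
  apply: le_trans (ler_normD _ _) _.
  by rewrite -natr1 mulrDl mul1r addrC lerD // qc.
Qed.

End CyclicPairing.

Arguments pairing {R m n} s q p.
Arguments inside {R m n} C.
Arguments cyclic_polar {R m n} s i0 C.

(** * Existence of weak billiard trajectories by duality *)

Section WeakBilliards.
Variables (R : realType) (n : nat).
Implicit Types (C K T : set 'rV[R]_n).

(* A Minkowski billiard trajectory whose consecutive points may coincide. *)
Definition weak_billiard K T m (q p : 'I_m -> 'rV[R]_n) :=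
  [/\ inside K q, inside T p,
      forall i, normal_cone T (p i) (q (ordS i) - q i) &
      forall i, normal_cone K (q (ordS i)) (p i - p (ordS i))].

Lemma pairing_edge m s (x y p : 'I_m -> 'rV[R]_n) :
  (forall i, x (s i) - x i = y (s i) - y i) ->
  pairing s x p = pairing s y p.
Proof. by move=> xy; apply: eq_bigr => i _; rewrite xy. Qed.

Lemma pairing0l m s (p : 'I_m -> 'rV[R]_n) : pairing s (fun=> 0) p = 0.
Proof. by apply: big1 => i _; rewrite subrr dotp0l. Qed.

(** Moving a single vertex of the maximiser changes only one term of the pairing. *)
Lemma inside_max_normal m s K (p x : 'I_m -> 'rV[R]_n) : inside K x ->
  (forall y, inside K y -> pairing s p y <= pairing s p x) ->
  forall i, normal_cone K (x i) (p (s i) - p i).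
Proof.
move=> Kx xmax i; apply/normal_coneP => z Kz.
pose y j := if j == i then z else x j.
have /xmax : inside K y by move=> j; rewrite /y; case: eqP.
rewrite /pairing (bigD1 i) //= [leRHS](bigD1 i) //= {1}/y eqxx.
rewrite (eq_bigr (fun j => dotp (p (s j) - p j) (x j))).
  by rewrite lerD2r.
move=> j /negPf ji.
by rewrite /y ji.
Qed.

Lemma normal_max_inside m s K (p x y : 'I_m -> 'rV[R]_n) :
  (forall i, normal_cone K (x i) (p (s i) - p i)) -> inside K y ->
  pairing s p y <= pairing s p x.
Proof.
by move=> Nx Ky; apply: ler_sum => i _; move: (Nx i) => /normal_coneP; apply.
Qed.

Lemma pairing_max_inside m s C (p : 'I_m -> 'rV[R]_n) : compact C -> C !=set0 ->
  exists2 x, inside C x &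
    forall y, inside C y -> pairing s y p <= pairing s x p.
Proof.
move=> cC [c Cc].
have [||||x [_ [Cx -> M]]] := pairing_max R m n s [set p] (inside C).
- exact: compact_set1.
- exact: compact_inside.
- by exists p.
- by exists (fun=> c).
by exists x => // y Cy; apply: M.
Qed.

(** Bipolar form of [pairing_separation]. Only positive bounds [g] are tested, since these can be
    rescaled to [1]. *)
Lemma edges_inside m s C (q : 'I_m -> 'rV[R]_n) :
  compact C -> Defs.convex_set C -> C 0 ->
  (forall p (g : R), 0 < g -> (forall x, inside C x -> pairing s x p <= g) ->
     pairing s q p <= g) ->
  exists2 x, inside C x & forall i, x (s i) - x i = q (s i) - q i.
Proof.
move=> cC convC C0 qC; apply: pairing_separation => // p.
have [x Cx M] := pairing_max_inside m s C p cC (ex_intro _ 0 C0).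
(* The maximum may be [0], so it is enlarged by an arbitrary [e > 0]. *)
exists x => //; apply/ler_addgt0Pr => e e0; apply: qC.
  by rewrite ltr_wpDl // -(pairing0l m s p); apply: M => i.
by move=> y Cy; apply: le_trans (M _ Cy) _; rewrite lerDl ltW.
Qed.

Lemma cyclic_polar_scale m s i0 C (q : 'I_m -> 'rV[R]_n) (g : R) : 0 < g ->
  (forall t, inside C t -> pairing s q t <= g) ->
  cyclic_polar s i0 C (fun i => g^-1 *: q i - g^-1 *: q i0).
Proof.
move=> g0 qg; split=> [|t Ct]; first by rewrite subrr.
by rewrite pairing_subl pairingZl ler_pdivrMl // mulr1 qg.
Qed.

Lemma ordS_connect m (i : 'I_m.+1) : fconnect (@ordS m.+1) ord0 i.
Proof.
have iterE k : (k < m.+1)%N -> val (iter k (@ordS m.+1) ord0) = k.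
  by elim: k => //= k IHk km; rewrite IHk ?modn_small // ltnW.
suff -> : i = iter i (@ordS _) ord0 by exact: fconnect_iter.
by apply: val_inj; rewrite /= iterE.
Qed.

Lemma ord_pred_connect m (i : 'I_m.+1) : fconnect (@ord_pred m.+1) ord0 i.
Proof.
rewrite fconnect_sym; last exact: ord_pred_inj.
rewrite -(iter_findex (ordS_connect m i)).
elim: (findex _ _ _) => //= k IHk.
apply: connect_trans IHk; rewrite -{2}[iter k _ _](@ordSK m.+1).
exact: fconnect1.
Qed.

(* The pairing is maximised over the product of the two polar sets, and the
   bipolar theorem ([edges_inside]) in each factor puts the rescaled maximiser
   inside the bodies. *)
Lemma weak_billiard_exists K T m (y p : 'I_m -> 'rV[R]_n) (g L : R) :
  convex_body K -> convex_body T -> 0 < g -> 0 < L ->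
  0 < pairing (@ordS m) y p ->
  (forall t, inside T t -> pairing (@ordS m) y t <= g) ->
  (forall x, inside K x -> pairing (@ordS m) x p <= L) ->
  exists q t, [/\ weak_billiard K T m q t, 0 < pairing (@ordS m) q t &
    pairing (@ordS m) q t * pairing (@ordS m) y p <= g * L].
Proof.
case: m y p => [|m] y p [cK [convK K0]] [cT [convT T0]] g0 L0 yp yg pL.
  by move: yp; rewrite /pairing big_ord0 ltxx.
pose B (x t : 'I_m.+1 -> 'rV[R]_n) := pairing (@ordS _) x t.
have BE x t : B x t = pairing (@ord_pred _) t x by exact: pairing_ordS.
pose P := cyclic_polar (@ord_pred m.+1) ord0 K.
pose Q := cyclic_polar (@ordS m.+1) ord0 T.
have P0 : P (fun=> 0) by split=> // t _; rewrite pairing0l ler01.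
have Q0 : Q (fun=> 0) by split=> // t _; rewrite pairing0l ler01.
have [||||qm [pm [Qqm Ppm BM]]] := pairing_max R m.+1 n (@ordS _) P Q.
- by apply: compact_cyclic_polar => //; exact: ord_pred_connect.
- by apply: compact_cyclic_polar => //; exact: ordS_connect.
- by exists (fun=> 0).
- by exists (fun=> 0).
pose b := B qm pm.
(* Dividing by the bounds puts the pair into the polar sets, where [b] is the maximum; homogeneity
   scales back. *)
have Bb q t (g1 g2 : R) : 0 < g1 -> 0 < g2 ->
    (forall t, inside T t -> B q t <= g1) ->
    (forall x, inside K x -> B x t <= g2) -> B q t <= b * (g1 * g2).
  move=> g10 g20 qg tg.
  have Qq := cyclic_polar_scale _ _ ord0 _ _ _ g10 qg.
  have tg' x : inside K x -> pairing (@ord_pred _) t x <= g2.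
    by move=> Kx; rewrite -BE tg.
  have Pt := cyclic_polar_scale _ _ ord0 _ _ _ g20 tg'.
  have := BM _ _ Qq Pt; rewrite -[leRHS]/b pairing_subl pairing_ordS.
  rewrite pairing_subl pairingZl -pairing_ordS pairingZl -/(B _ _).
  by rewrite !ler_pdivrMl // mulrA mulrC.
have b0 : 0 < b.
  have := Bb y p g L g0 L0 yg pL; have gL : 0 < g * L by exact: mulr_gt0.
  by move=> /(lt_le_trans yp); rewrite pmulr_lgt0.
(* By [Bb] with first bound [1], any bound [r] on the $K$-length of [t] yields [B qm t <= b * r];
   hence the edges of [b^-1 *: qm] are realised inside $K$. *)
have [||||q Kq qE] := 
  edges_inside m.+1 (@ordS _) K (fun i => b^-1 *: qm i) => //.
- exact: interior_subset.
- move=> t r r0 tr; rewrite pairingZl ler_pdivrMl // -[r]mul1r.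
  by apply: Bb => // t' Tt'; case: Qqm => _; apply.
have [||||t Tt tE] := 
  edges_inside m.+1 (@ord_pred _) T (fun i => b^-1 *: pm i) => //.
- exact: interior_subset.
- move=> x r r0 xr; rewrite pairingZl ler_pdivrMl // -[r]mulr1 -pairing_ordS.
  apply: Bb => // [t' Tt'|x' Kx']; first by rewrite BE xr.
  by rewrite BE; case: Ppm => _; apply.
have Bq t' : B q t' = b^-1 * B qm t'.
  by rewrite /B -pairingZl; exact: pairing_edge.
have Bt x' : B x' t = b^-1 * B x' pm.
  by rewrite !BE -pairingZl; exact: pairing_edge.
(* Each factor is scaled by [b^-1], and [B qm pm = b] cancels one of them. *)
have Bqt : B q t = b^-1 by rewrite Bq Bt -/b mulVf ?mulr1 // gt_eqF.
have b1 : 0 <= b^-1 by rewrite invr_ge0 ltW.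
exists q, t; rewrite -/(B _ _) Bqt; split; last 2 first.
- by rewrite invr_gt0.
- by rewrite ler_pdivrMl // Bb.
split=> // i.
(* Since [qm] is in the polar, [B q t' <= b^-1 = B q t]: so [t] is a maximiser, and normality
   follows. *)
- apply: inside_max_normal Tt _ i => t' Tt'; rewrite -!/(B _ _) Bqt Bq.
  by rewrite ler_piMr //; case: Qqm => _; apply.
- have := inside_max_normal m.+1 (@ord_pred _) K t q Kq.
  move=> /(_ _ (ordS i)); rewrite ordSK; apply => x Kx; rewrite -!BE Bqt Bt.
  by rewrite ler_piMr // BE; case: Ppm => _; apply.
Qed.

End WeakBilliards.

Arguments weak_billiard {R n} K T {m} q p.

(** * Deleting repeated vertices from a cyclic polygon *)

Lemma lift_ordS m (j : 'I_m.+2) (i : 'I_m.+1) :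
  lift j (ordS i) = if ordS (lift j i) == j then ordS j else ordS (lift j i).
Proof.
have ordSE k (a : 'I_k) : nat_of_ord (ordS a) = if a.+1 == k then 0%N else a.+1.
  rewrite /=; have := ltn_ord a; rewrite leq_eqVlt => /orP[/eqP ->|ak].
    by rewrite eqxx modnn.
  by rewrite modn_small // ltn_eqF.
apply: ord_inj; rewrite (fun_if (@nat_of_ord _)) -(inj_eq (@ord_inj _)).
have liftE (k : 'I_m.+1) : nat_of_ord (lift j k) = bump j k by [].
rewrite !(liftE, ordSE) /bump.
by move: (ltn_ord i) (ltn_ord j); do !case: ifP; lia.
Qed.

Lemma sum_lift_ordS (V : nmodType) m (j : 'I_m.+2)
    (c : 'I_m.+2 -> 'I_m.+2 -> V) :
  c (ord_pred j) j + c j (ordS j) = c (ord_pred j) (ordS j) ->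
  \sum_i c (lift j i) (lift j (ordS i)) = \sum_i c i (ordS i).
Proof.
move=> cj; rewrite [RHS](bigD1_ord j) //=.
(* This needs at least two indices, hence the [m.+2]. *)
have jp : j != ord_pred j.
  rewrite -(inj_eq (@ordS_inj _)) ord_predK -(inj_eq val_inj) /=.
  have := ltn_ord j; rewrite leq_eqVlt => /orP[/eqP jm|jm].
    by rewrite jm modnn; lia.
  by rewrite modn_small //; lia.
have [i0 i0E] : exists i0, lift j i0 = ord_pred j.
  by case: (unlift_some jp) => i0 ->; exists i0.
rewrite (bigD1 i0) //= [\sum_(i < m.+1) _ in RHS](bigD1 i0) //= lift_ordS.
rewrite i0E ord_predK eqxx -cj addrA [c j _ + _]addrC; congr (_ + _).
apply: eq_bigr => i ii0; rewrite lift_ordS; case: eqP => // ij.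
by case/eqP: ii0; apply: (@lift_inj _ j); rewrite i0E -[in RHS]ij ordSK.
Qed.

Section Contraction.
Variables (R : realType) (n : nat).
Implicit Types (C K T : set 'rV[R]_n).

Lemma normal_coneD C z u v :
  normal_cone C z u -> normal_cone C z v -> normal_cone C z (u + v).
Proof.
move=> Nu Nv y Cy; rewrite dotpDl.
by have := Nu y Cy; have := Nv y Cy; lra.
Qed.

Lemma normal_coneZ C z (k : R) v : 0 < k ->
  normal_cone C z (k *: v) -> normal_cone C z v.
Proof. by move=> k0 N y /N; rewrite dotpZl pmulr_rle0. Qed.

(** Only the merged edge from [ord_pred j] to [ordS j] brings new conditions. *)
Lemma weak_billiard_drop K T m (q p : 'I_m.+2 -> 'rV[R]_n) (j : 'I_m.+2) :
  weak_billiard K T q p ->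
  normal_cone T (p (ord_pred j)) (q (ordS j) - q (ord_pred j)) ->
  normal_cone K (q (ordS j)) (p (ord_pred j) - p (ordS j)) ->
  weak_billiard K T (q \o lift j) (p \o lift j).
Proof.
move=> [Kq Tp NT NK] NTj NKj; split=> i //=; try exact: Kq; try exact: Tp.
- rewrite lift_ordS; case: eqP => [ij|_]; last exact: NT.
  by rewrite -[lift j i]ordSK ij.
- rewrite lift_ordS; case: eqP => [ij|_]; last exact: NK.
  by rewrite -[lift j i]ordSK ij.
Qed.

(** The issue is that no vertex lies between its neighbours. Otherwise both edges at [q j] are
    positive multiples of one [w], normal to $T$ at two consecutive [p], which strict convexity
    identifies. *)
Lemma weak_billiard_strict K T m (q p : 'I_m -> 'rV[R]_n) : (2 <= m)%N ->
  T° 0 -> strictly_convex T -> weak_billiard K T q p ->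
  (forall j, q (ordS j) != q j) -> (forall j, p (ordS j) != p j) ->
  minkowski_billiard K T q /\ ell T q = pairing (@ordS m) q p.
Proof.
move=> m2 T0 sT [Kq Tp NT NK] qq pp; split; last first.
  by apply: eq_bigr => j _; rewrite (mu_polarE _ _ _ (p j)).
have NKj j : normal_cone K (q j) (p (ord_pred j) - p j).
  by have := NK (ord_pred j); rewrite ord_predK.
have ppj j : p (ord_pred j) - p j != 0.
  by rewrite subr_eq0 eq_sym; have := pp (ord_pred j); rewrite ord_predK.
split; first split=> // j; first split; first by rewrite eq_sym.
  move=> [l /= /andP[l0 l1] qj].
  pose w := q (ordS j) - q (ord_pred j).
  have e1 : q (ordS (ord_pred j)) - q (ord_pred j) = l *: w.
    by rewrite ord_predK -qj /w; apply/rowP => k; rewrite !mxE; ring.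
  have e2 : q (ordS j) - q j = (1 - l) *: w.
    by rewrite -qj /w; apply/rowP => k; rewrite !mxE; ring.
  have := qq (ord_pred j); rewrite -subr_eq0 e1 scaler_eq0 negb_or.
  move=> /andP[ln0 w0].
  have := qq j; rewrite -subr_eq0 e2 scaler_eq0 negb_or w0 andbT => l1n.
  have := NT (ord_pred j); rewrite e1 => /normal_coneZ N1.
  have := NT j; rewrite e2 => /normal_coneZ N2.
  have := ppj j; rewrite subr_eq0 => /eqP; apply.
  apply: (strictly_convex_normal_inj _ _ T _ _ w) => //.
    by apply: N1; rewrite lt_def ln0.
  by apply: N2; rewrite lt_def l1n subr_ge0.
split=> [j|]; first exact: normal_bdry (Kq j) (ppj j) (NKj j).
exists p => j; split; [|split=> //].
  by apply: normal_bdry (Tp j) _ (NT j); rewrite subr_eq0.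
by rewrite opprB.
Qed.

(** Induction on the number of vertices: a repetition in [q] or in [p] allows one index to be
    dropped without changing the pairing, whose positivity excludes ending with fewer than two
    vertices. *)
Lemma weak_billiard_contract K T m (q p : 'I_m -> 'rV[R]_n) :
  T° 0 -> strictly_convex T -> weak_billiard K T q p ->
  0 < pairing (@ordS m) q p ->
  exists m' (q' : 'I_m' -> 'rV[R]_n),
    minkowski_billiard K T q' /\ ell T q' = pairing (@ordS m) q p.
Proof.
move=> T0 sT; elim: m q p => [|[|m] IHm] q p wqp qp0.
- by move: qp0; rewrite /pairing big_ord0 ltxx.
- by move: qp0; rewrite /pairing big1 ?ltxx // => i _; rewrite !ord1 subrr dotp0l.
have drop j : weak_billiard K T (q \o lift j) (p \o lift j) ->
    dotp (q j - q (ord_pred j)) (p (ord_pred j)) + dotp (q (ordS j) - q j) (p j)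
    = dotp (q (ordS j) - q (ord_pred j)) (p (ord_pred j)) ->
    exists m' (q' : 'I_m' -> 'rV[R]_n),
      minkowski_billiard K T q' /\ ell T q' = pairing (@ordS m.+2) q p.
  move=> wj ej.
  have E : pairing (@ordS _) (q \o lift j) (p \o lift j) =
      pairing (@ordS _) q p.
    exact: (sum_lift_ordS _ _ j (fun i k => dotp (q k - q i) (p i))).
  by rewrite -E; apply: IHm => //; rewrite E.
have [Kq Tp NT NK] := wqp.
have [[j qj]|qq] := pselect (exists j, q (ordS j) = q j).
  have NTj := NT (ord_pred j); have NKj := NK (ord_pred j).
  rewrite ord_predK in NTj NKj.
  apply: (drop j); last by rewrite qj subrr dotp0l addr0.
  apply: weak_billiard_drop => //; rewrite ?qj //.
  rewrite -(subrK (p j) (p _)) -addrA; apply: normal_coneD => //.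
  by rewrite -{1}qj.
(* Here [ordS j] is dropped: both edges of [q] at this vertex are normal to $T$ at the same point,
   hence so is their sum. *)
have [[j pj]|pp] := pselect (exists j, p (ordS j) = p j).
  have eT : q (ordS j) - q j + (q (ordS (ordS j)) - q (ordS j)) =
      q (ordS (ordS j)) - q j.
    by rewrite addrC addrA subrK.
  apply: (drop (ordS j)); last first.
    by rewrite ordSK pj -dotpDl eT.
  apply: weak_billiard_drop => //; rewrite ordSK.
    rewrite -eT; apply: normal_coneD; first exact: NT.
    by rewrite -pj; exact: NT.
  by rewrite -pj; exact: NK.
exists m.+2, q; apply: weak_billiard_strict => // j; apply/eqP => E.
  by apply: qq; exists j.
by apply: pp; exists j.
Qed.

End Contraction.

(** * From linear relations between edges to shorter trajectories *)

(** Partial sums; the vanishing total accounts for the edge from the last index back to the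
    first. *)
Lemma cyclic_primitive (V : zmodType) m (f : 'I_m -> V) : \sum_i f i = 0 ->
  exists y : 'I_m -> V, forall i, y (ordS i) - y i = f i.
Proof.
move=> f0; exists (fun i : 'I_m => \sum_(k < m | (k < i)%N) f k) => i.
have : \sum_(k < m | (k < i)%N) f k + f i = \sum_(k < m | (k <= i)%N) f k.
  rewrite [RHS](bigD1 i) //= addrC; congr (_ + _); apply: eq_bigl => k.
  by rewrite ltn_neqAle andbC.
move=> E; apply/eqP; rewrite subr_eq addrC E; apply/eqP.
have := ltn_ord i; rewrite leq_eqVlt => /orP[/eqP im|im].
  rewrite {1}/ordS /= im modnn big_pred0 // -[LHS]f0; apply: eq_bigl => k.
  by rewrite -ltnS im ltn_ord.
by rewrite /= modn_small.
Qed.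

Section Shortening.
Variables (R : realType) (n : nat).
Implicit Types (K T : set 'rV[R]_n).

Lemma ordS_neq m (j : 'I_m) : (2 <= m)%N -> ordS j != j.
Proof.
move=> m2; rewrite -(inj_eq (@ord_inj _)) /=.
have := ltn_ord j; rewrite leq_eqVlt => /orP[/eqP jm|jm].
  by rewrite jm modnn; lia.
by rewrite modn_small //; lia.
Qed.

(** If [p (ordS j) = p j], two successive edges of [q] are normal to $T$ at one point; by smoothness
    they are positively parallel, so their common vertex lies between its neighbours. *)
Lemma minkowski_billiard_weak K T m (q : 'I_m -> 'rV[R]_n) :
  compact K -> compact T -> T° 0 -> smooth_body T ->
  minkowski_billiard K T q ->
  exists p, [/\ weak_billiard K T q p, forall j, p (ordS j) != p j &
    ell T q = pairing (@ordS m) q p].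
Proof.
move=> cK cT T0 sT [[_ qE] [bq [p pE]]].
have Tp j : T (p j) by apply: bdry_compact => //; case: (pE j).
exists p; split.
- split=> // j; first exact: bdry_compact.
    by case: (pE j) => _ [].
  by case: (pE j) => _ [_]; rewrite opprB.
- move=> j; apply/eqP => pj.
  have [bp [N1 _]] := pE j; have [_ [N2 _]] := pE (ordS j).
  rewrite pj in N2.
  have v0 i : q (ordS i) - q i != 0 by rewrite subr_eq0 eq_sym; case: (qE i).
  have [c c0 E] :=
    smooth_normal_parallel _ _ _ _ _ _ T0 sT bp (v0 _) (v0 _) N1 N2.
  case: (qE (ordS j)) => _; apply; rewrite ordSK.
  have c1 : 1 + c != 0 by rewrite gt_eqF //; lra.
  exists (1 + c)^-1; first by rewrite /= invr_ge0 invf_le1; lra.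
  have -> : q (ordS (ordS j)) = q (ordS j) + c *: (q (ordS j) - q j).
    by rewrite -E addrC subrK.
  by apply/rowP => k; rewrite !mxE; field.
- by apply: eq_bigr => j _; apply: mu_polarE => //; case: (pE j) => _ [].
Qed.

(** Changing [p j] to [p (ord_pred j)] amounts to replacing [x j] by [x (ordS j)], which gives [y].
    Equality would force [y = q] by strict convexity, but [y] repeats a vertex where [q] does
    not. *)
Lemma weak_billiard_shorten K T m (q p x : 'I_m -> 'rV[R]_n) (j : 'I_m) :
  (2 <= m)%N -> strictly_convex K -> weak_billiard K T q p ->
  (forall i, p (ordS i) != p i) -> q (ordS j) != q j -> inside K x ->
  pairing (@ordS m) x (fun i => if i == j then p (ord_pred j) else p i) <
  pairing (@ordS m) q p.
Proof.
move=> m2 sK [Kq _ _ NK] pp qj Kx.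
have jS : ordS j != j by exact: ordS_neq.
have Pj : ord_pred j != j by rewrite -(inj_eq (@ordS_inj _)) ord_predK eq_sym.
pose y i := if i == j then x (ordS j) else x i.
have Ky : inside K y by move=> i; rewrite /y; case: eqP.
have -> : pairing (@ordS m) x (fun i => if i == j then p (ord_pred j) else p i)
    = pairing (@ordS m) y p.
  rewrite !pairing_ordS /pairing (bigD1 j) //= (bigD1 (ordS j)) //=.
  rewrite [RHS](bigD1 j) //= [X in _ = _ + X](bigD1 (ordS j)) //=.
  rewrite /y !eqxx (negPf jS) (negPf Pj) ordSK eqxx subrr dotp0l add0r addrA.
  rewrite -dotpDl [p _ - p j + _]addrA subrK; congr (_ + _).
  apply: eq_bigr => i /andP[/negPf ij iSj]; rewrite ij; case: eqP => // pij.
  by rewrite -pij ord_predK eqxx in iSj.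
have NKp i : normal_cone K (q i) (p (ord_pred i) - p i).
  by have := NK (ord_pred i); rewrite ord_predK.
rewrite lt_def; apply/andP; split; last first.
  by rewrite !pairing_ordS; exact: normal_max_inside.
apply/eqP; rewrite !pairing_ordS => /eqP; rewrite -subr_eq0 -sumrB psumr_eq0.
  move=> /allP eqs.
  have yq i : y i = q i.
    have := eqs i (mem_index_enum _); rewrite subr_eq0 => /eqP E.
    apply: (strictly_convex_normal_inj _ _ K _ _ (p (ord_pred i) - p i)) => //.
      by rewrite subr_eq0 eq_sym; have := pp (ord_pred i); rewrite ord_predK.
    apply/normal_coneP => z Kz; rewrite -E.
    by move: (NKp i) => /normal_coneP; apply.
  by case/eqP: qj; rewrite -!yq /y eqxx (negPf jS).
move=> i _; rewrite subr_ge0.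
by move: (NKp i) => /normal_coneP; apply.
Qed.

(** A nonzero [mu] yields a polygon [y] which, paired with the modified [p'], produces a trajectory
    shorter than [q]. *)
Lemma ell_minimizing_edges K T m (q : 'I_m -> 'rV[R]_n)
    (mu : 'I_m -> R) (j : 'I_m) :
  convex_body K -> strictly_convex K ->
  convex_body T -> strictly_convex T -> smooth_body T ->
  ell_minimizing K T q ->
  (forall i, 0 <= mu i) -> mu j = 0 ->
  \sum_i mu i *: (q (ordS i) - q i) = 0 -> forall i, mu i = 0.
Proof.
move=> bK sK bT sT smT [bq qmin] mu0 muj muv i.
have [cK [_ K0]] := bK; have [cT [_ T0]] := bT.
have [p [wqp pp ellq]] := minkowski_billiard_weak _ _ _ _ cK cT T0 smT bq.
have [[m2 qE] _] := bq; have [Kq Tp NT NK] := wqp.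
have v0 k : q (ordS k) - q k != 0 by rewrite subr_eq0 eq_sym; case: (qE k).
have vp k : 0 < dotp (q (ordS k) - q k) (p k) 
  by exact: (normal_dotp_gt0 _ _ T _ _ T0 (NT k) (v0 k)).
have [y yE] := cyclic_primitive _ _ _ muv.
pose p' k := if k == j then p (ord_pred j) else p k.
apply/eqP; apply: contraT => mui.
pose g := pairing (@ordS m) y p.
(* The edge of [y] at [j] is zero, so the change of [p j] is invisible. *)
have gE : pairing (@ordS m) y p' = g.
  apply: eq_bigr => k _; rewrite yE /p'; case: eqP => // ->.
  by rewrite muj scale0r !dotp0l.
have yT t : inside T t -> pairing (@ordS m) y t <= g.
  move=> Tt; apply: ler_sum => k _; rewrite yE !dotpZl ler_wpM2l //.
  by move: (NT k) => /normal_coneP; apply.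
have g0 : 0 < g.
  rewrite /g /pairing (bigD1 i) //= ltr_pwDl //.
    by rewrite yE dotpZl mulr_gt0 // lt_def mui mu0.
  by apply: sumr_ge0 => k _; rewrite yE dotpZl mulr_ge0 // ltW.
pose L := ell T q.
have L0 : 0 < L.
  rewrite /L ellq /pairing (bigD1 i) //= ltr_pwDl //.
  by apply: sumr_ge0 => k _; exact: ltW.
have K00 : K 0 by exact: interior_subset.
have [x Kx xM] := pairing_max_inside R n m (@ordS m) K p' cK (ex_intro _ 0 K00).
have xL : pairing (@ordS m) x p' < L.
  rewrite /L ellq; apply: (weak_billiard_shorten K T) => //.
  by rewrite -subr_eq0.
(* A bound strictly between the $K$-length of [p'] and [L]; the maximum with [0] ensures that it is
   positive. *)
pose L' := (Num.max 0 (pairing (@ordS m) x p') + L) / 2.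
have L'0 : 0 < L'.
  by rewrite divr_gt0 // ltr_wpDl // le_max lexx.
have xL' : Num.max 0 (pairing (@ordS m) x p') < L by rewrite gt_max L0.
have [||t Kt|q' [t [wqt qt0 qtL]]] :=
  weak_billiard_exists R n K T m y p' g L' bK bT g0 L'0; rewrite ?gE //.
- apply: le_trans (xM _ Kt) _.
  apply: (@le_trans _ _ (Num.max 0 (pairing (@ordS m) x p'))).
    by rewrite le_max lexx orbT.
  by rewrite /L'; lra.
have [m' [q'' [bq'' ellq'']]] :=
  weak_billiard_contract R n K T m q' t T0 sT wqt qt0.
have := qmin _ _ bq''; rewrite ellq'' leNgt; case/negP.
have : pairing (@ordS m) q' t <= L'.
  by move: qtL; rewrite gE mulrC ler_pM2l.
by rewrite -/L /L'; lra.
Qed.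

(** Summation by parts, with [b] a cyclic primitive of the shifted coefficients. *)
Lemma affine_relation_edges m (q : 'I_m -> 'rV[R]_n) (c : 'I_m -> R) :
  \sum_i c i = 0 -> \sum_i c i *: q i = 0 ->
  exists2 b : 'I_m -> R, \sum_i b i *: (q (ordS i) - q i) = 0 &
    forall i, b (ordS i) - b i = c (ordS i).
Proof.
move=> c0 cq; have : \sum_i c (ordS i) = 0.
  by rewrite -[RHS]c0 [RHS](reindex_inj (@ordS_inj m)).
move=> /cyclic_primitive[b bE]; exists b => //.
transitivity (- \sum_i c (ordS i) *: q (ordS i)); last first.
  by rewrite -[RHS]oppr0 -[in RHS]cq [in RHS](reindex_inj (@ordS_inj m)).
under eq_bigr do rewrite scalerBr.
rewrite sumrB [X in _ - X](reindex_inj (@ordS_inj m)) -sumrB -sumrN.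
by apply: eq_bigr => i _; rewrite -bE -scalerBl -scaleNr opprB.
Qed.

Lemma edges_free m (q : 'I_m.+1 -> 'rV[R]_n) :
  (forall (mu : 'I_m.+1 -> R) j, (forall i, 0 <= mu i) -> mu j = 0 ->
     \sum_i mu i *: (q (ordS i) - q i) = 0 -> forall i, mu i = 0) ->
  free [tuple q (lift ord0 i) - q ord0 | i < m].
Proof.
move=> edges; apply/freeP => k kX i.
have {}kX : \sum_h k h *: (q (lift ord0 h) - q ord0) = 0.
  by rewrite -[RHS]kX; apply: eq_bigr => h _; rewrite -tnth_nth tnth_mktuple.
pose c (i : 'I_m.+1) := if unlift ord0 i is Some h then k h else - \sum_h k h.
have c0 : c ord0 = - \sum_h k h by rewrite /c unlift_none.
have cS h : c (lift ord0 h) = k h by rewrite /c liftK.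
have [||b bq bE] := affine_relation_edges m.+1 q c.
- rewrite big_ord_recl c0 [X in _ + X](eq_bigr k) ?addNr => // h _; exact: cS.
- rewrite big_ord_recl c0 -[RHS]kX scaleNr scaler_suml -sumrN -big_split.
  by apply: eq_bigr => h _ /=; rewrite cS scalerBr addrC.
(* The edges sum to zero, so subtracting the minimum of [b] preserves the relation and makes it
   nonnegative with a zero at [j]. Hence [b] is constant and its differences [c] vanish. *)
have [j _ bj] := @arg_minP _ _ _ ord0 xpredT b isT.
have mu0 := edges (fun i => b i - b j) j _ (subrr _) _.
have bc i' : b i' = b j.
  apply/eqP; rewrite -subr_eq0; apply/eqP; apply: mu0 => [h|].
    by rewrite subr_ge0 bj.
  under eq_bigr do rewrite scalerBl.
  rewrite sumrB bq sub0r -scaler_sumr sumrB.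
  rewrite [X in _ - X](reindex_inj (@ordS_inj _)).
  by rewrite subrr scaler0 oppr0.
by rewrite -cS -[lift _ _]ord_predK -bE !bc subrr.
Qed.

End Shortening.

(** * The dimension of the minimal affine section *)

Theorem theorem1p4 (R : realType) (n : nat) (K T : set 'rV[R]_n)
  (m : nat) (q : 'I_m -> 'rV[R]_n) (a : 'rV[R]_n) (U : {vspace 'rV[R]_n}) :
  convex_body K -> strictly_convex K -> smooth_body K ->
  convex_body T -> strictly_convex T -> smooth_body T ->
  ell_minimizing K T q ->
  (* K ∩ V is an affine section of K containing q ... *)
  (forall j, (K `&` aff a U) (q j)) ->
  (* ... and it is inclusion-minimal among such sections *)
  (forall (b : 'rV[R]_n) (W : {vspace 'rV[R]_n}),
      (forall j, (K `&` aff b W) (q j)) ->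
      K `&` aff b W `<=` K `&` aff a U -> K `&` aff b W = K `&` aff a U) ->
  \dim U = m.-1.
Proof.
move=> bK sK _ bT sT smT qmin qU Umin.
have edges mu j := ell_minimizing_edges R n K T m q mu j bK sK bT sT smT qmin.
have [[[m2 qE] _] _] := qmin; clear qmin.
case: m q m2 qE qU Umin edges => // m q m2 qE qU Umin /edges_free Xfree.
set X := [tuple _ | i < m] in Xfree; pose W := <<X>>%VS.
(* After the case split [m] is one less than the number of vertices, so it is the length of the free
   family [X]. *)
suff -> : U = W by move: Xfree; rewrite /free size_tuple => /eqP.
have diffU i j : q i - q j \in U.
  have [_ [u uU <-]] := qU i; have [_ [v vU <-]] := qU j.
  by rewrite opprD addrACA subrr add0r; apply: memvB.
have WU : (W <= U)%VS.
  by apply/span_subvP => v /tnthP[i ->]; rewrite tnth_mktuple.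
have diffW j : q j - q ord0 \in W.
  have [i ->|->] := unliftP ord0 j; last by rewrite subrr mem0v.
  apply: memv_span; apply/tnthP; exists i; by rewrite tnth_mktuple.
have qW j : (K `&` aff (q ord0) W) (q j).
  split; first by case: (qU j).
  by exists (q j - q ord0); [exact: diffW|rewrite addrC subrK].
have [_ [u0 u0U q0E]] := qU ord0.
have sec : K `&` aff (q ord0) W `<=` K `&` aff a U.
  move=> x [Kx [w wW xE]]; split=> //; exists (u0 + w).
    by apply: memvD => //; apply: (subvP WU).
  by rewrite -xE -q0E addrA.
have secE := Umin _ _ qW sec.
apply/eqP; rewrite eqEsubv WU andbT; apply/subvP => u uU.
(* Equal sections must give equal directions: the midpoint of [q ord0] and [q (ordS ord0)] is
   interior to $K$, so the section contains a small step from it along any [u] in [U]. *)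
have half : 0 < (2^-1 : R) < 1 by apply/andP; split; lra.
have [q01 _] := qE ord0.
have [Kq0 _] := qU ord0; have [Kq1 _] := qU (ordS ord0).
have := sK _ _ Kq0 Kq1 q01 _ half.
pose d := 2^-1 *: (q (ordS ord0) - q ord0).
have -> : (1 - 2^-1) *: q ord0 + 2^-1 *: q (ordS ord0) = q ord0 + d.
  by rewrite /d; apply/rowP => k; rewrite !mxE; lra.
move=> /(interior_segment _ _ _ _ u)[e e0 Ke].
have dW : d \in W by apply: memvZ.
have : (K `&` aff a U) (q ord0 + d + e *: u).
  split=> //; exists (u0 + d + e *: u); last by rewrite -q0E !addrA.
  by rewrite /= !memvD ?memvZ.
rewrite -secE => -[_ [w wW]]; rewrite -addrA => /addrI wE.
have : e *: u \in W by rewrite -(addrK d (e *: u)) [_ + d]addrC -wE memvB.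
move=> /(memvZ e^-1); rewrite scalerA mulVf ?scale1r //.
by rewrite gt_eqF.
Qed.
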